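(* If $T$ is a tree and $e\in E(\overline{T})$ (an edge joining two nonadjacent vertices of $T$), then $$\dim(T+e)\le Z(T+e)+1,$$ where $T+e$ is the unicyclic graph obtained from $T$ by adding $e$.
   Context: $\dim(G)$: metric dimension, the minimum size of a set $W\subseteq V(G)$ such that every pair of distinct vertices $u,v$ has some $w\in W$ with $d(u,w)\ne d(v,w)$. $Z(G)$: zero forcing number, the minimum size of an initial set of black vertices (others white) such that repeatedly applying the rule ''a white vertex that is the only white neighbor of a black vertex turns black'' eventually makes all vertices black. *)

(* Defs.v *)
From mathcomp Require Import all_boot.
Set Implicit Arguments.
Unset Strict Implicit.
Unset Printing Implicit Defensive.

(* A finite graph is given by its adjacency relation [e] on a finType. *)
Section Graphs.
Variables (V : finType) (e : rel V).

Definition simple_graph : Prop := symmetric e /\ irreflexive e.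

Definition connected_graph : Prop :=
  0 < #|V| /\ forall x y : V, connect e x y.

(* In a simple graph, the duplicate-free cyclic sequences of size at most 2 are
   the empty one and the ones that go back and forth along a single edge. *)
Definition acyclic_graph : Prop := forall c : seq V, ucycle e c -> size c <= 2.

Definition is_tree : Prop :=
  [/\ simple_graph, connected_graph & acyclic_graph].

Definition add_edge (a b : V) : rel V :=
  [rel x y | [|| e x y, (x == a) && (y == b) | (x == b) && (y == a)]].

Definition has_walk (n : nat) (x y : V) : bool :=
  [exists p : n.-tuple V, path e x p && (last x p == y)].

(* Length of a shortest walk from x to y.  Distances between connected
   vertices are below #|V|; the value #|V| means that there is no walk. *)
Definition dist (x y : V) : nat :=
  find (fun n => has_walk n x y) (iota 0 #|V|).

Definition resolving (W : {set V}) : bool :=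
  [forall u, forall v, (u != v) ==> [exists w in W, dist u w != dist v w]].

(* The minimum is well defined: see resolvingT. *)
Definition metric_dim : nat := #|[arg min_(W < [set: V] | resolving W) #|W| ]|.

(* With B the set of black vertices, u forces v. *)
Definition forces (B : {set V}) (u v : V) : bool :=
  [&& u \in B, v \notin B, e u v &
      [forall w, e u w && (w \notin B) ==> (w == v)]].

Definition color_change : rel {set V} :=
  [rel B B' | [exists u, exists v, forces B u v && (B' == v |: B)]].

(* Some sequence of single applications of the rule makes everything black. *)
Definition zero_forcing_set (S : {set V}) : bool :=
  connect color_change S [set: V].

(* The minimum is well defined: see zero_forcing_setT. *)
Definition zero_forcing : nat :=
  #|[arg min_(S < [set: V] | zero_forcing_set S) #|S| ]|.

Lemma dist_eq0 (x y : V) : (dist x y == 0) = (x == y).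
Proof.
have Vgt0 : 0 < #|V| by apply/card_gt0P; exists x.
rewrite /dist; case: #|V| Vgt0 => // n _ /=.
have -> : has_walk 0 x y = (x == y).
  apply/existsP/idP => [[p]|/eqP->]; first by rewrite tuple0.
  by exists [tuple]; rewrite /= eqxx.
by case: (x == y).
Qed.

Lemma resolvingT : resolving [set: V].
Proof.
apply/forallP=> u; apply/forallP=> v; apply/implyP=> neq_uv.
apply/existsP; exists u; rewrite inE /=; apply: contraNneq neq_uv => duv.
by rewrite eq_sym -dist_eq0 -duv dist_eq0.
Qed.

Lemma zero_forcing_setT : zero_forcing_set [set: V].
Proof. exact: connect0. Qed.

Lemma metric_dimP :
  (exists2 W : {set V}, resolving W & #|W| = metric_dim) /\
  (forall W : {set V}, resolving W -> metric_dim <= #|W|).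
Proof.
rewrite /metric_dim; case: arg_minnP => [|W rW minW]; first exact: resolvingT.
by split=> //; exists W.
Qed.

Lemma zero_forcingP :
  (exists2 S : {set V}, zero_forcing_set S & #|S| = zero_forcing) /\
  (forall S : {set V}, zero_forcing_set S -> zero_forcing <= #|S|).
Proof.
rewrite /zero_forcing; case: arg_minnP => [|S zS minS].
  exact: zero_forcing_setT.
by split=> //; exists S.
Qed.

End Graphs.

(* Main.v *)
Require Import Defs.
From mathcomp Require Import all_boot.
From mathcomp Require Import zify.

Set Implicit Arguments.
Unset Strict Implicit.
Unset Printing Implicit Defensive.

(* A fort is a nonempty vertex set F such that no vertex outside F has exactly
   one neighbour in F; a zero forcing set S meets every fort.  Let C be the cycle
   of T + e and let the foot of a vertex be its projection on C.
   - If u and v have the same foot, the vertices that distinguish u from v form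
     a fort, because distances to u and v inside the hanging tree are tree
     distances; so S itself resolves u and v.
   - For each vertex r of C the vertices whose foot is not r form a fort, because
     r has two neighbours on C; so the feet of S contain two vertices of C.
   - Add to S one vertex of C such that the three feet cut C into arcs of length
     at most |C|/2.  Three such points resolve all pairs with distinct feet: the
     points balancing u and v are at most one on each open arc between their
     feet, or all lie on one arc shorter than |C|/2. *)

(** * Walks, geodesics and distances in a connected graph *)

Section Distance.
Variables (V : finType) (e : rel V).
Hypotheses (e_sym : symmetric e) (e_conn : forall x y, connect e x y).
Local Notation d := (dist e).

Lemma dist_xx x : d x x = 0.
Proof. by apply/eqP; rewrite dist_eq0. Qed.

Lemma dist_path x p : path e x p -> d x (last x p) <= size p.
Proof.
move=> ep; rewrite leqNgt; apply/negP => lt_p.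
have szV : size p < #|V|.
  by apply: leq_trans lt_p _; rewrite -[#|V|](size_iota 0) find_size.
have := before_find 0 lt_p; rewrite nth_iota // add0n => /negbT/negP; apply.
by apply/existsP; exists (in_tuple p); rewrite /= ep eqxx.
Qed.

Lemma geodesic x y :
  exists p, [/\ path e x p, last x p = y, uniq (x :: p) & size p = d x y].
Proof.
have has_w : has (fun n => has_walk e n x y) (iota 0 #|V|).
  (* A simple path has length below [#|V|], so the search in [dist] succeeds and does not return its
     default. *)
  have /connectP[p ep ->] := e_conn x y.
  case/shortenP: ep => q eq Uq _.
  have szq : size q < #|V| by rewrite -[_.+1]/(size (x :: q)) -(card_uniqP Uq) max_card.
  apply/hasP; exists (size q); first by rewrite mem_iota.
  by apply/existsP; exists (in_tuple q); rewrite /= eq eqxx.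
have := nth_find 0 has_w; rewrite -/(dist e x y).
have lt_d : d x y < #|V| by rewrite -[#|V|](size_iota 0) -has_find.
rewrite nth_iota // add0n => /existsP[p /andP[ep /eqP last_p]].
have sz_p : size p = d x y by rewrite size_tuple.
move: (last_p); case/shortenP: ep => q eq Uq sub_qp last_q; exists q; split=> //.
apply/eqP; rewrite eqn_leq -{2}last_q dist_path // andbT -sz_p.
by apply: uniq_leq_size => //; case/andP: Uq.
Qed.

Lemma dist_triangle y x z : d x z <= d x y + d y z.
Proof.
have [p [ep <- _ <-]] := geodesic x y; have [q [eq <- _ <-]] := geodesic (last x p) z.
by rewrite -last_cat -size_cat dist_path // cat_path ep.
Qed.

Lemma dist_sym x y : d x y = d y x.
Proof.
suff le z t : d z t <= d t z by apply/eqP; rewrite eqn_leq !le.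
have [p [ep <- _ <-]] := geodesic t z.
have := @dist_path (last t p) (rev (belast t p)).
rewrite size_rev size_belast.
rewrite rev_path (eq_path (e' := e)) => [/(_ ep)|x' y']; last exact: e_sym.
by case: p ep => [|s p] // _; rewrite /= rev_cons last_rcons.
Qed.

Lemma dist_edge u x y : e x y -> d u y <= d u x + 1.
Proof.
move=> exy; apply: leq_trans (dist_triangle x u y) _; rewrite leq_add2l.
by have := @dist_path x [:: y]; rewrite /= exy; apply.
Qed.

Lemma dist_pred u x : 0 < d u x -> exists2 y, e x y & d u x = d u y + 1.
Proof.
have [p] := geodesic u x; case/lastP: p => [|p z] [+ + _ sz]; first by rewrite -sz.
rewrite rcons_path last_rcons => /andP[ep elz] zx _.
rewrite {}zx in elz; exists (last u p); first by rewrite e_sym.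
apply/eqP; rewrite eqn_leq dist_edge // -sz size_rcons addn1 ltnS; exact: dist_path.
Qed.

Lemma dist_geodesic x y p z : path e x p -> last x p = y -> size p = d x y ->
  z \in x :: p -> d x z + d z y = d x y.
Proof.
move=> ep ly szp /splitPl zp; case: zp ep ly szp => p1 p2 lz.
rewrite cat_path last_cat lz size_cat => /andP[ep1 ep2] ly szp.
have := dist_path ep1; have := dist_path ep2; have := dist_triangle z x y.
rewrite lz ly; lia.
Qed.

(** Together with [dist_le_descent] this certifies a guessed distance formula: slow growth along
    edges gives one inequality, a descending neighbour everywhere gives the other. *)
Lemma le_dist_lipschitz (f : V -> nat) u : f u = 0 ->
  (forall x y, e x y -> f y <= f x + 1) -> forall w, f w <= d u w.
Proof.
move=> fu fe w; have [p [ep <- _ <-]] := geodesic u w.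
elim/last_ind: p ep => [|p z IH]; first by rewrite /= fu.
rewrite rcons_path last_rcons size_rcons => /andP[ep ez].
have := fe _ _ ez; have := IH ep; lia.
Qed.

Lemma dist_le_descent (f : V -> nat) u :
  (forall w, w != u -> exists2 y, e w y & f y < f w) -> forall w, d u w <= f w.
Proof.
move=> fe w; have [k] := ubnP (f w); elim: k w => // k IH w lt_k.
have [->|/fe[y ewy lt_y]] := eqVneq w u; first by rewrite dist_xx.
have := @dist_edge u y w; rewrite e_sym => /(_ ewy).
have := IH y; lia.
Qed.

End Distance.

(** * Zero forcing sets and forts *)

Section ZeroForcing.
Variables (V : finType) (e : rel V).

(* The sets F satisfying the last two hypotheses are the forts of the graph. *)
Lemma zero_forcing_meets_fort (S F : {set V}) :
  zero_forcing_set e S -> F != set0 ->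
  (forall x y, x \notin F -> y \in F -> e x y ->
     exists2 z, z \in F & e x z && (z != y)) ->
  exists2 w, w \in S & w \in F.
Proof.
move=> /connectP[s]; elim: s S => [|B s IH] S /= + + F0 fortF.
  by move=> _ <-; have /set0Pn[w wF] := F0; exists w; rewrite ?inE.
case/andP=> /existsP[u /existsP[v /andP[/and4P[uS vS euv /forallP onlyv]]]].
move=> /eqP-> es lasts; have [w] := IH _ es lasts F0 fortF.
rewrite in_setU1 => /predU1P[->|wS] wF; last by exists w.
have [uF|uF] := boolP (u \in F); first by exists u.
have [z zF /andP[euz zv]] := fortF _ _ uF wF euv; exists z => //.
by apply: contraNT zv => zS; have := onlyv z; rewrite euz zS.
Qed.

End ZeroForcing.

(** * Distances in trees *)

Section Tree.
Variables (V : finType) (e : rel V).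
Hypotheses (e_sym : symmetric e) (e_irr : irreflexive e).
Hypotheses (e_conn : forall x y, connect e x y).
Hypothesis e_acyclic : acyclic_graph e.
Local Notation d := (dist e).

(** Once the common start is removed, paths that diverge meet again, and the pieces up to the first
    meeting would close up into a cycle. *)
Lemma acyclic_path_unique x p q : path e x p -> path e x q ->
  last x p = last x q -> uniq (x :: p) -> uniq (x :: q) -> p = q.
Proof.
elim: p x q => [|p1 p IH] x q.
  move=> _ _ /= lastq _ /andP[+ _]; case: q lastq => //= q1 q ->.
  by rewrite mem_last.
case: q => [|q1 q].
  by move=> _ _ /= lastp /andP[+ _]; rewrite -lastp mem_last.
have [<- /= /andP[_ ep] /andP[_ eq] lastpq /andP[_ Up] /andP[_ Uq]|] := eqVneq p1 q1.
  by congr cons; apply: (IH p1).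
move=> pq1 ep eq lastpq Up Uq; case/eqP: pq1.
have hasp : has (mem (q1 :: q)) (p1 :: p).
  apply/hasP; exists (last x (p1 :: p)); first exact: (mem_last p1 p).
  by rewrite lastpq; apply: (mem_last q1 q).
change (head x (p1 :: p) = head x (q1 :: q)).
move: (p1 :: p) (q1 :: q) => {IH}p' q' in ep eq lastpq Up Uq hasp *.
(* z is the first vertex after x where the two paths meet again. *)
case: (split_find hasp) ep lastpq Up => z pa pb zq /hasPn pa_q ep _ Up.
move: eq Uq pa_q; case/splitPr: zq => qa qb eq Uq pa_q.
have [epa eaz] : path e x pa /\ e (last x pa) z.
  by move: ep; rewrite cat_path rcons_path => /andP[/andP[]].
have eqz : path e x (rcons qa z).
  by move: eq; rewrite -cat_rcons cat_path => /andP[].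
have ezq : path e z (rcons (rev qa) x).
  have := rev_path e x (rcons qa z); rewrite last_rcons belast_rcons rev_cons => ->.
  by rewrite (eq_path (e' := e)).
have cyc : ucycle e (x :: pa ++ z :: rev qa).
  apply/andP; split; first by rewrite /= rcons_cat rcons_cons cat_path epa /= eaz.
  move: Up Uq; rewrite /= !cat_uniq !mem_cat mem_rcons rcons_uniq !inE !negb_or !mem_rev.
  move=> /andP[/andP[/andP[-> ->] _] /and3P[/andP[zpa ->] _ _]].
  move=> /andP[/andP[-> _] /and3P[qaU /andP[zqa _] _]].
  rewrite /= zpa rev_uniq mem_rev zqa qaU /= !andbT.
  apply/hasPn => t; rewrite mem_rev => tqa; apply/negP => /pa_q /=.
  by rewrite mem_cat tqa.
(* Having at most two vertices, the cycle leaves [pa] and [qa] empty, so both paths start with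
   [z]. *)
have := e_acyclic cyc; rewrite /= size_cat /= size_rev => small.
by clear -small; case: pa qa small => [|? ?] [|? ?] //=; lia.
Qed.

Lemma tree_dist_uniq x p : path e x p -> uniq (x :: p) -> d x (last x p) = size p.
Proof.
move=> ep Up; have [q [eq lastq Uq <-]] := geodesic e_conn x (last x p).
by rewrite (acyclic_path_unique ep eq).
Qed.

Lemma tree_geodesic_rcons u x y p : path e u p -> last u p = x ->
  uniq (u :: p) -> size p = d u x -> e x y -> d u x <= d u y ->
  path e u (rcons p y) /\ uniq (u :: rcons p y).
Proof.
move=> ep lastp Up szp exy le_xy; rewrite rcons_path ep lastp exy.
rewrite -rcons_cons rcons_uniq Up; split=> //; rewrite andbT; apply/negP => yp.
have dyx := dist_geodesic e_conn ep lastp szp yp.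
have /eqP : d y x = 0 by lia.
by rewrite dist_eq0 => /eqP yx; move: exy; rewrite yx e_irr.
Qed.

(** A geodesic to an end not farther from [u], extended by the edge, is a simple path, and simple
    paths in a tree are geodesics. *)
Lemma tree_dist_edge u x y : e x y -> d u y = d u x + 1 \/ d u x = d u y + 1.
Proof.
wlog le_xy : x y / d u x <= d u y.
  move=> IH exy; have [|/ltnW] := leqP (d u x) (d u y); first by move=> /IH; apply.
  by move=> /IH; rewrite e_sym => /(_ exy) [|]; [right|left].
move=> exy; left; have [p [ep lastp Up szp]] := geodesic e_conn u x.
have [ey Uy] := tree_geodesic_rcons ep lastp Up szp exy le_xy.
by rewrite -szp addn1 -(size_rcons p y) -(tree_dist_uniq ey Uy) last_rcons.
Qed.

Lemma tree_pred_unique u x y z : e x y -> e x z ->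
  d u x = d u y + 1 -> d u x = d u z + 1 -> y = z.
Proof.
rewrite ![e x _]e_sym => eyx ezx dy dz.
have [p [ep lastp Up szp]] := geodesic e_conn u y.
have [q [eq lastq Uq szq]] := geodesic e_conn u z.
have [|epx Upx] := tree_geodesic_rcons ep lastp Up szp eyx; first by lia.
have [|eqx Uqx] := tree_geodesic_rcons eq lastq Uq szq ezx; first by lia.
have := acyclic_path_unique epx eqx; rewrite !last_rcons => /(_ erefl Upx Uqx).
by move=> /rcons_inj[pq]; rewrite -lastp -lastq pq.
Qed.

(** Triangle inequalities through a vertex shared by the geodesics from [a] to [u] and from [v] to
    [b] would give [d a v + d b u <= d a u + d b v], which is off by 2. So the edge joins them into
    a simple path. *)
Lemma tree_edge_between a b u v : e u v -> d a v = d a u + 1 -> d b u = d b v + 1 ->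
  d a u + 1 + d b v = d a b.
Proof.
move=> euv dav dbu.
have [p [ep lastp Up szp]] := geodesic e_conn a u.
have [q [eq lastq Uq szq]] := geodesic e_conn v b.
have epq : path e a (p ++ v :: q) by rewrite cat_path ep /= lastp euv.
have dS := dist_sym e_sym e_conn.
have Upq : uniq (a :: p ++ v :: q).
  rewrite -cat_cons cat_uniq Up Uq andbT; apply/hasPn => y yq; apply/negP => yp.
  have := dist_geodesic e_conn ep lastp szp yp.
  have := dist_geodesic e_conn eq lastq szq yq.
  have := dist_triangle e_conn y a v; have := dist_triangle e_conn y b u.
  rewrite (dS v y) (dS b y) (dS v b); lia.
have := tree_dist_uniq epq Upq.
by rewrite last_cat /= lastq size_cat /= szp szq (dS v b) => ->; lia.
Qed.

End Tree.

(** * Distances on a cycle of length [g] *)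

Definition cycle_dist g i j := minn (i - j + (j - i)) (g - (i - j + (j - i))).

(* A point r at height 0 sees p and q, raised by hp and hq, at the same distance
   (with one inequality lost when r is p or q) only if r lies behind p (first
   two cases, according to which arc from p to q is short), or behind q (next
   two), or is the single balance point of one of the two open arcs. *)
Lemma cycle_bisector g p q r hp hq : p < q -> q < g -> r < g ->
  (r <> p -> hp + cycle_dist g p r <= hq + cycle_dist g q r) ->
  (r <> q -> hq + cycle_dist g q r <= hp + cycle_dist g p r) ->
     (hq + q <= hp + p /\
       (r <= p /\ 2 * q <= g + 2 * r \/ q < r /\ g + 2 * q <= 2 * r))
  \/ (hq + p + g <= hp + q /\ p <= r /\ g + 2 * r <= 2 * q)
  \/ (hp + q <= hq + p /\
       (q <= r /\ 2 * r <= g + 2 * p \/ r < p /\ g + 2 * r <= 2 * p))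
  \/ (hp + p + g <= hq + q /\ r <= q /\ g + 2 * p <= 2 * r)
  \/ (hp < hq + (q - p) /\ hq < hp + (q - p) /\
      hp < hq + (g - (q - p)) /\ hq < hp + (g - (q - p)) /\
       ((p < r /\ r < q /\ hp + 2 * r = hq + q + p) \/
        (q < r /\ hp + g + p + q = hq + 2 * r) \/
        (r < p /\ hp + p + q = hq + g + 2 * r))).
Proof.
move=> pq qg rg; rewrite /cycle_dist.
have [rp|rp|rp] := ltngtP r p; have [rq|rq|rq] := ltngtP r q; try lia;
  case: (leqP (p - r + (r - p))) => wp; case: (leqP (q - r + (r - q))) => wq;
  lia.
Qed.

(** The gap conditions bound all three arcs, including the one through 0, by [g / 2]. Each of the
    three points falls in a case of [cycle_bisector], and no combination of cases is compatible with
    these gaps. *)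
Lemma cycle_triple_resolves g i j k p q hp hq :
  i < j -> j < k -> k < g -> p < g -> q < g -> p <> q ->
  2 * (j - i) <= g -> 2 * (k - j) <= g -> g <= 2 * (k - i) ->
  (forall r, r = i \/ r = j \/ r = k ->
    (r <> p -> hp + cycle_dist g p r <= hq + cycle_dist g q r) /\
    (r <> q -> hq + cycle_dist g q r <= hp + cycle_dist g p r)) -> False.
Proof.
wlog : p q hp hq / p < q => [W|pq ij jk kg _ qg _ gij gjk gki bis].
  move=> ij jk kg pg qg pq gij gjk gki bis.
  have [lt|lt|//] := ltngtP p q; first exact: (W p q hp hq).
  by apply: (W q p hq hp) => // [/esym//|r /bis[]].
have [ig jg] : i < g /\ j < g by lia.
have [bi bi'] := bis i (or_introl erefl).
have [bj bj'] := bis j (or_intror (or_introl erefl)).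
have [bk bk'] := bis k (or_intror (or_intror erefl)).
have {bi bi'}ki := cycle_bisector pq qg ig bi bi'.
have {bj bj'}kj := cycle_bisector pq qg jg bj bj'.
have {bk bk' bis}kk := cycle_bisector pq qg kg bk bk'.
move: kj kk; case: ki => [ki|[ki|[ki|[ki|ki]]]];
 move=> [kj|[kj|[kj|[kj|kj]]]]; try (move=> _; lia);
 move=> [kk|[kk|[kk|[kk|kk]]]]; lia.
Qed.

(** * Coordinates along the path from [a] to [b] in the tree *)

Section Unicyclic.
Variables (V : finType) (e : rel V) (a b : V).
Hypotheses (e_sym : symmetric e) (e_irr : irreflexive e).
Hypotheses (e_conn : forall x y, connect e x y) (e_acyclic : acyclic_graph e).
Local Notation d := (dist e).
Local Notation n := (d a b).
Local Notation G := (add_edge e a b).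

Let d_sym := dist_sym e_sym e_conn.
Let d_tri := dist_triangle e_conn.

(* In a tree, [u] hangs off the [a]-[b] path at distance [height u] from the
   path, at the vertex of the path with distance [foot u] from [a]. *)
Definition height u := (d a u + d b u - n)./2.
Definition foot u := d a u - height u.

(** Along a tree edge both distances change by exactly 1, so the parity of their sum is constant.
    This makes the halving in [height] exact. *)
Lemma dist_ends_parity u : ~~ odd (d a u + d b u + n).
Proof.
have [k] := ubnP (d a u); elim: k u => // k IH u lt_k.
have [/eqP|u_gt0] := posnP (d a u).
  by rewrite dist_eq0 => /eqP <-; rewrite dist_xx (d_sym b a); lia.
have [y euy dy] := dist_pred e_sym e_conn u_gt0.
have := IH y; have := tree_dist_edge e_sym e_irr e_conn e_acyclic b euy; lia.
Qed.

Lemma foot_heightP u :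
  [/\ d a u = height u + foot u, d b u + foot u = height u + n & foot u <= n].
Proof.
have := dist_ends_parity u; have := d_tri u a b; have := d_tri a b u.
have := d_tri b a u; rewrite /foot /height (d_sym b a) (d_sym u b).
by split; lia.
Qed.

Lemma foot_height_ends : [/\ foot a = 0, height a = 0, foot b = n & height b = 0].
Proof.
have [+ + _] := foot_heightP a; have [+ + _] := foot_heightP b.
by rewrite !dist_xx (d_sym b a); split; lia.
Qed.

(** If the distances to [a] and [b] change in the same direction, the edge lies in a hanging tree;
    otherwise [tree_edge_between] puts it on the path from [a] to [b]. *)
Lemma foot_height_edge x y : e x y ->
  (foot x = foot y /\ (height y = height x + 1 \/ height x = height y + 1)) \/
  (height x = 0 /\ height y = 0 /\ (foot y = foot x + 1 \/ foot x = foot y + 1)).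
Proof.
move=> exy; have eyx : e y x by rewrite e_sym.
have [ax bx fx] := foot_heightP x; have [ay bay fy] := foot_heightP y.
have ea := tree_dist_edge e_sym e_irr e_conn e_acyclic a exy.
have eb := tree_dist_edge e_sym e_irr e_conn e_acyclic b exy.
case: ea => ea; case: eb => eb; [left; lia|right|right|left; lia].
  have := tree_edge_between e_sym e_conn e_acyclic exy ea eb; lia.
have := tree_edge_between e_sym e_conn e_acyclic eyx ea eb; lia.
Qed.

Lemma height_pred u : 0 < height u ->
  exists y, [/\ e u y, foot y = foot u & height u = height y + 1].
Proof.
move=> hu; have [ax bx fx] := foot_heightP u.
have [|y euy dy] := @dist_pred _ _ e_sym e_conn a u; first lia.
exists y; have := foot_height_edge euy; have [] := foot_heightP y; split=> //; lia.
Qed.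

Lemma foot_pred u : height u = 0 -> 0 < foot u ->
  exists y, [/\ e u y, height y = 0 & foot u = foot y + 1].
Proof.
move=> hu; have [ax bx fx] := foot_heightP u => fu.
have [|y euy dy] := @dist_pred _ _ e_sym e_conn a u; first lia.
exists y; have := foot_height_edge euy; have [] := foot_heightP y; split=> //; lia.
Qed.

Lemma foot_succ u : height u = 0 -> foot u < n ->
  exists y, [/\ e u y, height y = 0 & foot y = foot u + 1].
Proof.
move=> hu; have [ax bx fx] := foot_heightP u => fu.
have [|y euy dy] := @dist_pred _ _ e_sym e_conn b u; first lia.
exists y; have := foot_height_edge euy; have [] := foot_heightP y; split=> //; lia.
Qed.

Lemma foot_exists k : k <= n -> exists2 c, height c = 0 & foot c = k.
Proof.
have [fa ha _ _] := foot_height_ends.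
elim: k => [|k IH] lt_k; first by exists a.
have [c hc fc] := IH (ltnW lt_k); have [|y [_ hy fy]] := foot_succ hc; first lia.
by exists y; lia.
Qed.

(** By induction the neighbours of [x] and [y] one step closer to [a] coincide in [x']; then [x] and
    [y] are both the unique neighbour of [x'] closer to [b]. *)
Lemma foot_inj x y : height x = 0 -> height y = 0 -> foot x = foot y -> x = y.
Proof.
elim: {x}(foot x) {-2}x y (erefl (foot x)) => [|k IH] x y fx hx hy fxy.
  have [ax _ _] := foot_heightP x; have [ay _ _] := foot_heightP y.
  have /eqP : d a x = 0 by lia.
  have /eqP : d a y = 0 by lia.
  by rewrite !dist_eq0 => /eqP <- /eqP.
have [|x' [ex hx' fx']] := foot_pred hx; first lia.
have [|y' [ey hy' fy']] := foot_pred hy; first lia.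
have xy' : x' = y' by apply: IH => //; lia.
rewrite -{}xy' in ey hy' fy'.
apply: (tree_pred_unique e_sym e_irr e_conn e_acyclic (u := b) (x := x')).
- by rewrite e_sym.
- by rewrite e_sym.
- by have [] := foot_heightP x; have [] := foot_heightP x'; lia.
- by have [] := foot_heightP y; have [] := foot_heightP x'; lia.
Qed.

Lemma dist_foot u w : height w = 0 -> foot u = foot w -> d u w = height u.
Proof.
move=> hw; elim: {u}(height u) {-2}u (erefl (height u)) => [|k IH] u hu fu.
  by rewrite (foot_inj hu hw fu) dist_xx.
have [|y [euy fy hy]] := height_pred (u := u); first lia.
have := IH y; have := dist_edge e_conn w (x := y) (y := u).
rewrite e_sym euy (d_sym w y) (d_sym w u) => /(_ isT).
have := d_tri w a u; rewrite (d_sym w u).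
by have [] := foot_heightP u; have [] := foot_heightP w; lia.
Qed.

Lemma dist_same_foot u w : foot u = foot w -> d u w <= height u + height w.
Proof.
move=> fuw; have [_ _ fu] := foot_heightP u; have [c hc fc] := foot_exists fu.
by have := d_tri c u w; rewrite (d_sym c w) !(dist_foot hc) ?fc.
Qed.

Lemma dist_foot_lt u w : foot u < foot w ->
  d u w = height u + height w + (foot w - foot u).
Proof.
(* Keeping the true distance up to [foot u] leaves only the region beyond to verify; the two
   formulas are glued at the path vertex with that foot. *)
pose f x := if foot x <= foot u then d u x else height u + height x + (foot x - foot u).
have at_foot x : height x = 0 -> foot x = foot u -> f x = height u.
  by move=> hx fx; rewrite /f fx leqnn dist_foot.
suff df : d u w = f w by rewrite df /f => lt_uw; rewrite leqNgt lt_uw.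
apply/eqP; rewrite eqn_leq; apply/andP; split.
  apply: dist_le_descent => // x xu; rewrite {2}/f; case: (leqP (foot x)) => fx.
    have [|y exy dy] := @dist_pred _ _ e_sym e_conn u x.
      by rewrite lt0n dist_eq0 eq_sym.
    exists y => //; have := foot_height_edge exy.
    rewrite /f; case: (leqP (foot y)) => fy; first lia.
    move=> ?; have := @dist_foot u x; have := d_tri y b u; rewrite (d_sym y u).
    by have [] := foot_heightP u; have [] := foot_heightP y; lia.
  have [hx|/height_pred[y [exy fy hy]]] := posnP (height x); last first.
    by exists y => //; rewrite /f fy (leqNgt (foot x)) fx /=; lia.
  have [|y [exy hy fy]] := foot_pred hx; first lia.
  exists y => //; have [|fy'] := ltnP (foot u) (foot y).
    by rewrite /f; case: (leqP (foot y)); lia.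
  by rewrite at_foot //; lia.
apply: le_dist_lipschitz => //; first by rewrite /f leqnn dist_xx.
move=> x y exy; have := foot_height_edge exy.
rewrite /f; case: (leqP (foot x)) => fx; case: (leqP (foot y)) => fy; try lia.
- by have := dist_edge e_conn u exy.
- by have := @dist_foot u x; lia.
- by have := @dist_foot u y; lia.
Qed.

(** * Distances after adding the edge *)

Lemma add_edge_connected x y : connect G x y.
Proof.
apply: (connect_sub _ (e_conn x y)) => u v euv.
by apply: connect1; rewrite /add_edge /= euv.
Qed.

(** A shortest path crosses the new edge at most once, in either direction. Triangle inequalities
    give one bound; for the other, the right-hand side is 1-Lipschitz along old and new edges. *)
Lemma dist_add_edge u w : dist G u w =
  minn (d u w) (minn (d u a + 1 + d b w) (d u b + 1 + d a w)).
Proof.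
pose f x := minn (d u x) (minn (d u a + 1 + d b x) (d u b + 1 + d a x)).
rewrite -/(f w); apply/eqP; rewrite eqn_leq; apply/andP; split.
  have le_dG x y : dist G x y <= d x y.
    have [p [ep <- _ <-]] := geodesic e_conn x y; apply: dist_path.
    by apply: sub_path ep => s t; rewrite /add_edge /= => ->.
  have trG := dist_triangle add_edge_connected.
  have Gab : dist G a b <= 1.
    by apply: (@dist_path _ G a [:: b]); rewrite /add_edge /= !eqxx orbT.
  have Gba : dist G b a <= 1.
    by apply: (@dist_path _ G b [:: a]); rewrite /add_edge /= !eqxx !orbT.
  have := trG a u w; have := trG b a w; have := trG b u w; have := trG a b w.
  have := le_dG u w; have := le_dG u a; have := le_dG u b.
  have := le_dG b w; have := le_dG a w; rewrite /f; lia.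
apply: (le_dist_lipschitz add_edge_connected); first by rewrite /f dist_xx min0n.
move=> x y /or3P[exy|/andP[/eqP-> /eqP->]|/andP[/eqP-> /eqP->]].
- have := dist_edge e_conn u exy; have := dist_edge e_conn a exy.
  have := dist_edge e_conn b exy; rewrite /f; lia.
- rewrite /f !dist_xx; lia.
- rewrite /f !dist_xx; lia.
Qed.

(** Either detour over the new edge costs [height u + height w + n + 1], more than the route through
    the common foot. *)
Lemma dist_add_edge_same_foot u w : foot u = foot w -> dist G u w = d u w.
Proof.
move=> fuw; rewrite dist_add_edge; have := dist_same_foot fuw.
have [] := foot_heightP u; have [] := foot_heightP w.
by rewrite (d_sym u a) (d_sym u b); lia.
Qed.

Lemma dist_add_edge_neq_foot u w : foot u <> foot w ->
  dist G u w = height u + height w + cycle_dist (n + 1) (foot u) (foot w).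
Proof.
move=> fuw; rewrite dist_add_edge /cycle_dist (d_sym u a) (d_sym u b).
have [] := foot_heightP u; have [] := foot_heightP w.
have [lt|lt|//] := ltngtP (foot u) (foot w); first by rewrite (dist_foot_lt lt); lia.
by rewrite (d_sym u w) (dist_foot_lt lt); lia.
Qed.

(** For equal feet the cycle formula is only an upper bound, whence the guards [r <> p] and [r <> q]
    in [cycle_triple_resolves]. *)
Lemma dist_add_edge_le u w :
  dist G u w <= height u + height w + cycle_dist (n + 1) (foot u) (foot w).
Proof.
have [fuw|/eqP fuw] := eqVneq (foot u) (foot w).
  by rewrite dist_add_edge_same_foot //; have := dist_same_foot fuw; lia.
by rewrite dist_add_edge_neq_foot.
Qed.

Lemma add_edge_cross x y : G x y -> foot x <> foot y -> height x = 0 /\ height y = 0.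
Proof.
have [fa ha fb hb] := foot_height_ends.
move=> /or3P[/foot_height_edge|/andP[/eqP-> /eqP->]|/andP[/eqP-> /eqP->]] //; lia.
Qed.

(** * Forts of the unicyclic graph, whose cycle has length at least 3 *)

Hypothesis n_gt1 : 1 < n.

Lemma add_edge_same_foot x y : G x y -> foot x = foot y -> e x y.
Proof.
have [fa _ fb _] := foot_height_ends.
move=> /or3P[//|/andP[/eqP-> /eqP->]|/andP[/eqP-> /eqP->]]; lia.
Qed.

Lemma cycle_neighbors x : height x = 0 ->
  exists y z, [/\ G x y, G x z, foot y <> foot x, foot z <> foot x & y != z].
Proof.
have [fa ha fb hb] := foot_height_ends => hx.
have neq y z : foot y <> foot z -> y != z by move=> fyz; apply/eqP => yz; case: fyz; rewrite yz.
have sub y z : e y z -> G y z by rewrite /add_edge /= => ->.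
have [_ _ fx] := foot_heightP x.
have [fx0|fx_gt0] := posnP (foot x).
  have xa : x = a by apply: foot_inj; rewrite ?fx0.
  have [|y [exy hy fy]] := foot_succ hx; first lia.
  exists y, b; split; [exact: sub|by rewrite xa /add_edge /= !eqxx orbT|lia|lia|].
  by apply: neq; lia.
have [y [exy hy fy]] := foot_pred hx fx_gt0.
have [fxn|fx_ltn] := leqP n (foot x).
  have xb : x = b by apply: foot_inj => //; lia.
  exists y, a; split; [exact: sub|by rewrite xb /add_edge /= !eqxx !orbT|lia|lia|].
  by apply: neq; lia.
have [z [exz hz fz]] := foot_succ hx fx_ltn.
by exists y, z; split; [exact: sub|exact: sub|lia|lia|apply: neq; lia].
Qed.

Variable S : {set V}.
Hypothesis forcingS : zero_forcing_set G S.

Lemma zero_forcing_avoids_foot r : exists2 w, w \in S & foot w != r.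
Proof.
have [fa ha fb hb] := foot_height_ends.
have [||w wS] := zero_forcing_meets_fort (F := [set w | foot w != r]) forcingS.
- apply/set0Pn; have [r0|r0] := eqVneq (foot a) r; last by exists a; rewrite inE.
  by exists b; rewrite inE; lia.
- move=> x y; rewrite !inE negbK => /eqP fx fy Gxy.
  have [|hx _] := add_edge_cross Gxy; first by rewrite fx => fxy; rewrite fxy eqxx in fy.
  (* Both cycle neighbours of [x] leave foot [r], and one of them is not [y]. *)
  have [y1 [y2 [G1 G2 f1 f2 y12]]] := cycle_neighbors hx.
  rewrite fx in f1 f2; have [y1y|y1y] := eqVneq y1 y; last first.
    by exists y1; rewrite ?inE ?G1 //; apply/eqP.
  by exists y2; [rewrite inE; apply/eqP | rewrite G2 -y1y eq_sym].
by rewrite inE; exists w.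
Qed.

(* The vertices that distinguish u and v form a fort. *)
Lemma zero_forcing_resolves_same_foot u v : foot u = foot v -> u != v ->
  exists2 w, w \in S & dist G u w != dist G v w.
Proof.
move=> fuv uv; pose F := [set w | dist G u w != dist G v w].
suff : exists2 w, w \in S & w \in F by case=> w wS; rewrite inE; exists w.
apply: (zero_forcing_meets_fort forcingS).
  by apply/set0Pn; exists u; rewrite inE dist_xx eq_sym dist_eq0 eq_sym.
have distF w : foot w = foot u -> (w \in F) = (d u w != d v w).
  by move=> fw; rewrite inE !dist_add_edge_same_foot // -fuv.
have distF' w : foot w <> foot u -> (w \in F) = (height u != height v).
  move=> fw; have fw' : foot u <> foot w by move/esym.
  rewrite inE !dist_add_edge_neq_foot //; last by rewrite -fuv.
  by rewrite -fuv !eqn_add2r.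
have distF0 w : height w = 0 -> foot w = foot u -> (w \in F) = (height u != height v).
  by move=> hw fw; rewrite distF // !dist_foot // -fuv.
(* Off the common foot, and at the cycle vertex carrying it, membership in [F] is one and the same
   condition on heights. Edges between different feet join cycle vertices, so they cannot enter [F];
   hence [x] and [y] both have the common foot. *)
move=> x y xF yF Gxy; have [fx|/eqP fx] := eqVneq (foot x) (foot u); last first.
  rewrite (distF' x) // in xF; have [fy|/eqP fy] := eqVneq (foot y) (foot u).
    have [|_ hy] := add_edge_cross Gxy; first by rewrite fy.
    by rewrite distF0 // (negPf xF) in yF.
  by rewrite distF' // (negPf xF) in yF.
have [fy|/eqP fy] := eqVneq (foot y) (foot u); last first.
  have [|hx _] := add_edge_cross Gxy; first by rewrite fx => /esym.
  by rewrite distF' // -(distF0 x) // (negPf xF) in yF.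
have exy : e x y by apply: add_edge_same_foot Gxy _; rewrite fx.
clear distF0; move: xF yF; rewrite !distF // negbK => /eqP dx dy.
wlog ltd : u v F fuv uv distF distF' fx fy dx dy / d u y < d v y.
  move=> W; have [lt|lt|eqd] := ltngtP (d u y) (d v y).
  - exact: (W u v).
  - have FE : F = [set w | dist G v w != dist G u w].
      by apply/setP => w; rewrite !inE eq_sym.
    rewrite FE; apply: (W v u); rewrite -?FE -?fuv ?[v == u]eq_sym ?[d v y == _]eq_sym //.
    + by move=> w /distF ->; rewrite eq_sym.
    + by move=> w /distF' ->; rewrite eq_sym.
  - by rewrite eqd eqxx in dy.
have eu := tree_dist_edge e_sym e_irr e_conn e_acyclic u exy.
have ev := tree_dist_edge e_sym e_irr e_conn e_acyclic v exy.
(* Here [y] is closer to [u] and farther from [v] than [x] is. Take [z] one step from [x] towards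
   [v]: outside [F] it would be a second neighbour of [x] closer to [u]. *)
have [|z exz dz] := @dist_pred _ _ e_sym e_conn v x; first lia.
have eu' := tree_dist_edge e_sym e_irr e_conn e_acyclic u exz.
have zy : z != y by apply: contraTneq ltd => <-; lia.
exists z; last by rewrite zy andbT /add_edge /= exz.
(* A step off the common foot would lead away from [v]. *)
have fz : foot z = foot u.
  apply/eqP/negPn/negP => /eqP fz.
  have hxz := foot_height_edge exz; have dvx := @dist_foot v x.
  have := d_tri z a v; have := d_tri z b v; rewrite (d_sym z v).
  by have [] := foot_heightP v; have [] := foot_heightP z; lia.
rewrite distF //; apply: contraNneq zy => duz; apply/eqP.
by apply: (tree_pred_unique e_sym e_irr e_conn e_acyclic exz exy (u := u)); lia.
Qed.

End Unicyclic.

(** * Choice of the third cycle point, and the bound *)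

Lemma cycle_triple_exists g r1 r2 : r1 < r2 -> r2 < g -> 2 < g ->
  exists t i j k, [/\ t < g, [/\ i < j, j < k & k < g],
    [/\ 2 * (j - i) <= g, 2 * (k - j) <= g & g <= 2 * (k - i)] &
    forall r, r = i \/ r = j \/ r = k -> r = r1 \/ r = r2 \/ r = t].
Proof.
move=> r12 r2g g2; have [le_g|lt_g] := leqP (2 * (r2 - r1)) g; last first.
  (* The midpoint of the long arc: its length is at most [g - 1], so even the larger half is at most
     [g / 2]. *)
  exists (r1 + (r2 - r1)./2), r1, (r1 + (r2 - r1)./2), r2.
  by do !split; lia.
(* Otherwise [t] is the midpoint of the complementary arc, reduced modulo [g] when it wraps
   around. *)
have [lt_t|le_t] := ltnP (r2 + (g - (r2 - r1))./2) g.
  exists (r2 + (g - (r2 - r1))./2), r1, r2, (r2 + (g - (r2 - r1))./2).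
  by do !split; lia.
exists (r2 + (g - (r2 - r1))./2 - g), (r2 + (g - (r2 - r1))./2 - g), r1, r2.
by do !split; lia.
Qed.

Theorem theorem3p6 (V : finType) (T : rel V) (a b : V)
    (treeT : is_tree T) (neq_ab : a != b) (nadj_ab : ~~ T a b) :
  metric_dim (add_edge T a b) <= zero_forcing (add_edge T a b) + 1.
Proof.
have [[Tsym Tirr] [_ Tconn] Tacyc] := treeT.
have n_gt1 : 1 < dist T a b.
  rewrite ltnNge leq_eqVlt ltnS leqn0 dist_eq0 (negPf neq_ab) orbF.
  apply: contra nadj_ab => /eqP d1; have [p [ep lastp _]] := geodesic Tconn a b.
  rewrite d1; case: p ep lastp => [|c [|? ?]] //=.
  by rewrite andbT => Tac <-.
have [[S forcingS <-] _] := zero_forcingP (add_edge T a b).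
have meets := zero_forcing_avoids_foot Tsym Tirr Tconn Tacyc n_gt1 forcingS.
have [w1 [w2 [w1S w2S w12]]] :
    exists w1 w2, [/\ w1 \in S, w2 \in S & foot T a b w1 < foot T a b w2].
  (* The value 0 is arbitrary: it yields some vertex of [S], whose foot the second use avoids. *)
  have [w wS _] := meets 0; have [w' w'S] := meets (foot T a b w).
  by rewrite neq_ltn => /orP[?|?]; [exists w', w|exists w, w'].
have foot_le u : foot T a b u <= dist T a b.
  by have [] := foot_heightP a b Tsym Tirr Tconn Tacyc u.
have foot_lt u : foot T a b u < dist T a b + 1 by rewrite addn1 ltnS.
have [|t [i [j [k [tn [ij jk kn] [gij gjk gki] cover]]]]] :=
  cycle_triple_exists w12 (foot_lt w2); first lia.
have [|c _ fc] := @foot_exists _ T a b Tsym Tirr Tconn Tacyc t; first lia.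
have [_ minW] := metric_dimP (add_edge T a b).
apply: leq_trans (minW (c |: S) _) _; last by rewrite cardsU1; lia.
apply/forallP => u; apply/forallP => v; apply/implyP => uv.
have [fuv|/eqP fuv] := eqVneq (foot T a b u) (foot T a b v).
  have [w wS dw] := zero_forcing_resolves_same_foot
    Tsym Tirr Tconn Tacyc n_gt1 forcingS fuv uv.
  by apply/existsP; exists w; rewrite in_setU1 wS orbT.
apply: contraT => /existsPn unres; exfalso.
apply: (cycle_triple_resolves (hp := height T a b u) (hq := height T a b v)
  ij jk kn (foot_lt u) (foot_lt v) fuv gij gjk gki) => r /cover rP.
have [w wW <-] : exists2 w, w \in c |: S & foot T a b w = r.
  case: rP => [->|[->|->]]; [exists w1|exists w2|exists c] => //.
  - by rewrite in_setU1 w1S orbT.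
  - by rewrite in_setU1 w2S orbT.
  - by rewrite in_setU1 eqxx.
have := unres w; rewrite wW negbK => /eqP duv.
have leG := dist_add_edge_le a b Tsym Tirr Tconn Tacyc.
have eqG := @dist_add_edge_neq_foot _ T a b Tsym Tirr Tconn Tacyc.
(* The exact formula applies to the vertex whose foot differs from that of [w], the upper bound
   serves for the other, and [height w] cancels. *)
split=> fw.
  have := leG v w; rewrite -duv eqG; [lia|by move/esym].
have := leG u w; rewrite duv eqG; [lia|by move/esym].
Qed.
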